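(* (i) We have $f(p)\ge 0.378\log p$ for almost all primes $p$. Hence, $N(x)\gg x$ (for $x\ge 2$, with an absolute implied constant). (ii) For all real $x\ge 3$ and any positive integer $h$, $$\left|\{p\le x:\ p \text{ prime},\ f(p)=h\}\right|\le\left(\frac{6\log x}{h}\right)^h.$$
   Context: For positive integers $a,b$ write $a\prec b$ if $b\equiv 1\pmod a$. A prime chain (of length $k\ge 1$) is a sequence of primes $p_1\prec p_2\prec\cdots\prec p_k$. For a prime $p$, $f(p)$ is the number of prime chains ($k\ge 1$ variable) with $p_k=p$ (so $f(2)=1$ and $f(p)=1+\sum_{q\mid p-1,\ q\text{ prime}}f(q)$). $N(x)$ is the number of prime chains ($k$ variable) with $p_k\le x$. A property holds for almost all primes if the number of primes $p\le x$ failing it is $o(x/\log x)$ as $x\to\infty$. *)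

(* Defs.v *)
From mathcomp Require Import all_boot all_order all_algebra finmap.
From mathcomp Require Import all_classical all_reals all_analysis.
Set Implicit Arguments. Unset Strict Implicit. Unset Printing Implicit Defensive.
Import Order.TTheory GRing.Theory Num.Theory.
Import numFieldNormedType.Exports.
Local Open Scope classical_set_scope.

Definition prec (a b : nat) : bool := b == 1 %[mod a].

Definition prime_chain (c : seq nat) : bool :=
  [&& c != [::], all prime c & sorted prec c].

Definition chains_to (p : nat) : set (seq nat) :=
  [set c | prime_chain c /\ last 0 c = p].

Definition chains_upto (R : realType) (x : R) : set (seq nat) :=
  [set c | prime_chain c /\ ((last 0%N c)%:R <= x)%R].

(* [fset_set] is only meaningful on finite sets; see [finite_chains_to],
   [finite_chains_upto] and [finite_primes_upto] below. *)
Definition f (p : nat) : nat := #|` fset_set (chains_to p) |%fset.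

Definition N (R : realType) (x : R) : nat :=
  #|` fset_set (chains_upto x) |%fset.

Definition primes_upto (R : realType) (P : nat -> Prop) (x : R) : set nat :=
  [set p | [/\ prime p, (p%:R <= x)%R & P p]].

Definition count_primes (R : realType) (P : nat -> Prop) (x : R) : nat :=
  #|` fset_set (primes_upto P x) |%fset.

(* The Landau notations need a [filter_on] structure, which the library does
   not declare for [+oo]. *)
Canonical pinfty_filter_on (R : realType) :=
  FilterType (pinfty_nbhs R) _.

Definition almost_all_primes (R : realType) (P : nat -> Prop) : Prop :=
  ((fun x : R => (count_primes (fun p => ~ P p) x)%:R : R^o)
     =o_ (pinfty_nbhs R) (fun x : R => x / ln x : R^o))%R.

Lemma prec_dvd (a b : nat) : 0 < b -> prec a b = (a %| b.-1).
Proof. by move=> b0; rewrite /prec eqn_mod_dvd// subn1. Qed.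

Lemma prec_lt (p q : nat) : prime p -> prime q -> prec p q -> p < q.
Proof.
move=> pp pq; rewrite /prec (modn_small (prime_gt1 pp)) => /eqP h.
rewrite ltnNge; apply/negP; rewrite leq_eqVlt => /orP[/eqP e|lt].
  by rewrite e modnn in h.
by rewrite (modn_small lt) in h; rewrite h in pq.
Qed.

Lemma prime_chain_sorted c : prime_chain c -> sorted ltn c.
Proof.
case: c => [//|a s] /and3P[_ /=]; elim: s a => [//|b s IH] a /=.
move=> /and3P[pa pb ps] /andP[ab bs].
by rewrite (prec_lt pa pb ab) IH ?pb.
Qed.

Lemma finite_chains_le (n : nat) :
  finite_set [set c | prime_chain c /\ last 0 c <= n].
Proof.
pose g (A : {set 'I_n.+1}) := [seq val i | i <- enum A].
apply: (@sub_finite_set _ _ [set g A | A in [set: {set 'I_n.+1}]]); last first.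
  exact/finite_image/finite_finset.
move=> c [hc hn] /=; exists [set i : 'I_n.+1 | val i \in c]%SET => //.
have sc := prime_chain_sorted hc.
have le_c i : i \in c -> i < n.+1.
  move=> ic; rewrite ltnS (leq_trans _ hn)//.
  case/splitPr: ic sc => s t; rewrite last_cat /= => /cat_sorted2[_] /=.
  rewrite path_sortedE; last exact: ltn_trans.
  case/andP=> /allP h _; case: (lastP t) h => [//|t' z] h.
  by rewrite last_rcons; apply/ltnW/h; rewrite mem_rcons mem_head.
apply: (irr_sorted_eq ltn_trans ltnn) => //.
  rewrite /g {1}/enum_mem sorted_map.
  apply: sorted_filter; first by move=> ? ? ?; exact: ltn_trans.
  by rewrite -enumT -sorted_map val_enum_ord iota_ltn_sorted.
move=> i; apply/mapP/idP => [[j]|ic].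
  by rewrite mem_enum inE => ? ->.
by exists (Ordinal (le_c i ic)) => //; rewrite mem_enum inE.
Qed.

Lemma finite_chains_to (p : nat) : finite_set (chains_to p).
Proof.
by apply: sub_finite_set (finite_chains_le p) => c [hc <-]; split.
Qed.

Lemma leq_truncn_of (R : realType) (x : R) (n : nat) :
  (n%:R <= x)%R -> n <= Num.truncn x.
Proof. by move=> h; rewrite -(@natrK R n); exact: le_truncn. Qed.

Lemma finite_chains_upto (R : realType) (x : R) : finite_set (chains_upto x).
Proof.
apply: sub_finite_set (finite_chains_le (Num.truncn x)) => c [hc hx].
by split => //; exact: leq_truncn_of.
Qed.

Lemma finite_primes_upto (R : realType) (P : nat -> Prop) (x : R) :
  finite_set (primes_upto P x).
Proof.
apply: (@sub_finite_set _ _ `I_(Num.truncn x).+1); last exact: finite_II.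
by move=> p [_ hx _] /=; rewrite ltnS; exact: leq_truncn_of.
Qed.

Lemma almost_all_primesP (R : realType) (P : nat -> Prop) :
  almost_all_primes R P <->
  (forall e : R, 0 < e -> \forall x \near +oo,
     (count_primes (fun p => ~ P p) x)%:R <= e * (x / ln x))%R.
Proof.
have pos (x : R) : (1 < x -> 0 <= x / ln x)%R.
  by move=> x1; rewrite divr_ge0 ?ln_ge0 ?ltW// (lt_trans _ x1).
split=> [/eqoP|] H.
  move=> e e0; apply: filterS2 (H e e0) (nbhs_pinfty_gt (@real1 R)) => x.
  by rewrite normr_nat => + /pos x1; rewrite ger0_norm.
apply/eqoP => e e0.
apply: filterS2 (H e e0) (nbhs_pinfty_gt (@real1 R)) => x.
by rewrite normr_nat => + /pos x1; rewrite ger0_norm.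
Qed.

Lemma mem_chains_to (c : seq nat) (p : nat) :
  (c \in fset_set (chains_to p)) = prime_chain c && (last 0 c == p).
Proof.
rewrite in_fset_set; last exact: finite_chains_to.
by apply/idP/andP; rewrite inE => -[? /eqP].
Qed.

Lemma prime_chain_rcons (c : seq nat) (p : nat) : c != [::] ->
  prime_chain (rcons c p) =
  [&& prime_chain c, prime p & prec (last 0 c) p].
Proof.
case: c => [//|a c] _; rewrite /prime_chain rcons_cons /= all_rcons rcons_path.
by case: (prime p); case: (prime a); case: (all prime c); case: (path prec a c).
Qed.

Lemma f_rec (p : nat) : prime p -> f p = (1 + \sum_(q <- primes p.-1) f q)%N.
Proof.
move=> pp; pose S q : seq (seq nat) := fset_set (chains_to q).
pose L := [:: p] :: [seq rcons c p | q <- primes p.-1, c <- S q].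
have memL c : (c \in L) = (c \in S p).
  rewrite /S /= [RHS]mem_chains_to inE.
  apply/orP/andP => [[/eqP->|/allpairsPdep[q [d [qp dq ->]]]]|].
  - by rewrite /prime_chain /= pp eqxx.
  - move: dq; rewrite [d \in _]mem_chains_to => /andP[dc /eqP dl].
    have d0 : d != [::] by case/and3P: dc.
    rewrite last_rcons eqxx prime_chain_rcons// dc pp dl prec_dvd ?prime_gt0//.
    by move: qp; rewrite mem_primes => /and3P[_ _ ->].
  case/lastP: c => [|d q] [+ /eqP]; first by [].
  rewrite last_rcons => + qp; rewrite qp.
  have [->|d0] := eqVneq d [::]; first by left.
  rewrite prime_chain_rcons// => /and3P[dc _ dp]; right.
  apply/allpairsPdep; exists (last 0 d), d; split => //; last first.
    by rewrite [d \in _]mem_chains_to dc /=.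
  have pd : prime (last 0 d).
    case/and3P: dc => _ /allP h _; apply: h.
    by case: (d) d0 => //= a s _; exact: mem_last.
  rewrite mem_primes pd -subn1 subn_gt0 prime_gt1//= subn1.
  by rewrite -prec_dvd ?prime_gt0.
have uL : uniq L.
  rewrite /= allpairs_uniq_dep ?primes_uniq//=.
  - rewrite andbT; apply/negP => /allpairsPdep[q [c [_ + e]]].
    rewrite mem_chains_to => /andP[/and3P[c0 _ _] _].
    by case: c c0 e => // a [].
  - by move=> q _; exact: fset_uniq.
  - move=> [q c] [q' c'] /allpairsPdep[q1 [c1 [_ h [-> ->]]]].
    move=> /allpairsPdep[q2 [c2 [_ h' [-> ->]]]] /= /rcons_inj[e].
    move: h h'; rewrite e !mem_chains_to.
    by move=> /andP[_ /eqP<-] /andP[_ /eqP<-].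
have := perm_size (uniq_perm uL (fset_uniq _) memL).
rewrite -/(f p) => <-; rewrite /= add1n size_allpairs_dep; congr _.+1.
by rewrite sumnE big_map.
Qed.

(* Main.v *)
Require Import Defs.
From mathcomp Require Import all_boot all_order all_algebra finmap.
From mathcomp Require Import all_classical all_reals all_analysis.
From mathcomp Require Import ring lra zify.
Set Implicit Arguments. Unset Strict Implicit. Unset Printing Implicit Defensive.
Import Order.TTheory GRing.Theory Num.Theory.
Local Open Scope ring_scope.

(** Rankin's trick fed back into the recursion for [f].  Since
    [z ^ f p = z * \prod_(q | p - 1) z ^ f q], the sum of [z ^ f p * p ^ -s]
    over odd primes [p <= n] is at most the sum over even [m < n] of a
    multiplicative function, hence at most an Euler product over the primes
    [< n], i.e. [K * exp] of (essentially) the same sum over a shorter range.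
    If [K * e <= 1] the sum thus stays below 1 by induction on [n].
    Part (ii) takes [s = h / ln x] and [z = e s / 6]; part (i) takes [s = 3/8]
    and [z = exp (-1.652)], for which [s + 0.378 * 1.652 < 1].  The bound on
    [N] follows from (i) and Chebyshev's lower bound for the number of primes. *)

(** * Finite sums over integers and Euler products *)

Lemma ler_sum_inj (R : realType) (I J : finType) (A : {pred I}) (phi : I -> J)
    (G : J -> R) : {in A &, injective phi} -> (forall j, 0 <= G j) ->
  \sum_(i in A) G (phi i) <= \sum_j G j.
Proof.
move=> inj G0; rewrite -(big_imset G inj) [leRHS](bigID (mem (phi @: A)%SET)) /=.
by rewrite lerDl sumr_ge0.
Qed.

Lemma prod_logn_id (m n : nat) : (0 < m < n)%N ->
  (\prod_(q < n) q ^ logn q m)%N = m.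
Proof.
case/andP=> m0; case: n => // n mn.
by rewrite -[RHS](partnT m0) (@widen_partn n) ?big_mkord.
Qed.

Lemma sum_primes_ord (F : nat -> nat) (m n : nat) : (0 < m < n)%N ->
  \sum_(q <- primes m) F q = \sum_(q < n | (0 < logn q m)%N) F q.
Proof.
case/andP=> m0 mn; rewrite -(big_mkord (fun q => (0 < logn q m)%N)).
rewrite -big_filter; apply: perm_big; apply: uniq_perm.
- exact: primes_uniq.
- exact/filter_uniq/iota_uniq.
move=> q; rewrite mem_filter mem_index_iota /= logn_gt0 andb_idr//.
by rewrite mem_primes => /and3P[_ _ /dvdn_leq] h; rewrite (leq_ltn_trans (h m0)).
Qed.

Lemma geometric_le (R : realType) (u : R) (k : nat) : 0 <= u < 1 ->
  \sum_(a < k) u ^+ a <= (1 - u)^-1.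
Proof.
case/andP=> u0 u1; have d0 : 0 < 1 - u by rewrite subr_gt0.
rewrite -[leRHS]mul1r ler_pdivlMr// mulrC -opprB mulNr -subrX1 opprB.
by rewrite gerBl exprn_ge0.
Qed.

(* Each m is recovered from the tuple of its p-adic valuations, so a sum over
   m of a product of local factors is part of the expanded Euler product. *)
Lemma sum_le_euler (R : realType) (h : nat -> nat -> R) (n : nat) :
  (forall q a, 0 <= h q a) ->
  \sum_(m < n | (0 < m)%N) \prod_(q < n) h q (logn q m)
    <= \prod_(q < n) \sum_(a < n) h q a.
Proof.
case: n => [|n] h0; first by rewrite !big_ord0 ler01.
have ltl q (m : 'I_n.+1) : (0 < m)%N -> (logn q m < n.+1)%N.
  move=> m0; apply: leq_trans (ltn_ord m).
  by rewrite ltnS ltnW// ltn_logl.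
rewrite bigA_distr_bigA /=.
pose phi (m : 'I_n.+1) : {ffun 'I_n.+1 -> 'I_n.+1} := [ffun q : 'I_n.+1 => inord (logn q m)].
rewrite (eq_bigr (fun m => (fun g : {ffun 'I_n.+1 -> 'I_n.+1} =>
     \prod_(q < n.+1) h q (g q)) (phi m))); last first.
  by move=> m m0; apply: eq_bigr => q _; rewrite ffunE inordK// ltl.
apply: ler_sum_inj; last by move=> g; rewrite prodr_ge0.
move=> a b a0 b0 /ffunP e; apply: val_inj => /=.
transitivity (\prod_(q < n.+1) q ^ logn q a)%N.
  by rewrite (@prod_logn_id a n.+1)// ltn_ord andbT.
rewrite -[RHS](@prod_logn_id b n.+1) ?ltn_ord ?andbT//.
apply: eq_bigr => q _; congr (_ ^ _)%N.
have := congr1 (@nat_of_ord _) (e q).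
by rewrite !ffunE (inordK (ltl _ _ a0)) (inordK (ltl _ _ b0)).
Qed.

(** * The Rankin sum and its recursive bound *)

Section Rankin.
Variables (R : realType) (z s : R).
Hypotheses (z0 : 0 < z) (s0 : 0 < s).

Definition npow (m : nat) : R := expR (- s * ln m%:R).

Lemma npow_gt0 m : 0 < npow m. Proof. exact: expR_gt0. Qed.

Lemma npow1 : npow 1 = 1. Proof. by rewrite /npow ln1 mulr0 expR0. Qed.

Lemma npowM a b : (0 < a)%N -> (0 < b)%N -> npow (a * b) = npow a * npow b.
Proof.
by move=> a0 b0; rewrite /npow natrM lnM ?posrE ?ltr0n// mulrDr expRD.
Qed.

Lemma npow_lt1 m : (1 < m)%N -> npow m < 1.
Proof. by move=> m1; rewrite /npow expR_lt1 mulNr oppr_lt0 mulr_gt0 ?ln_gt0 ?ltr1n. Qed.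

Lemma le_npow a b : (0 < a)%N -> (a <= b)%N -> npow b <= npow a.
Proof.
move=> a0 ab; rewrite ler_expR !mulNr lerN2 ler_pM2l// ler_ln ?posrE ?ltr0n ?ler_nat//.
exact: leq_trans ab.
Qed.

Lemma npow_prod_logn m n : (0 < m < n)%N ->
  npow m = \prod_(q < n) npow q ^+ logn q m.
Proof.
move=> mn; rewrite -{1}(prod_logn_id mn).
suff [] : (0 < \prod_(q < n) q ^ logn q m)%N /\
  npow (\prod_(q < n) q ^ logn q m)%N = \prod_(q < n) npow q ^+ logn q m by [].
apply: (big_ind2 (fun (a : nat) (b : R) => (0 < a)%N /\ npow a = b)).
- by split=> //; exact: npow1.
- by move=> a x b y [a0 <-] [b0 <-]; rewrite muln_gt0 a0 b0 npowM.
(* At q = 0 the exponent [logn 0 m] is 0, so the factor is 0^0 = 1 and positivity survives. *)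
move=> [[|q] /= _] _; first by rewrite expr0 npow1.
elim: (logn _ m) => [|a [a0 IH]]; first by rewrite expr0 npow1.
by rewrite expnS exprS muln_gt0 a0 npowM// IH.
Qed.

(** The quotient is the geometric series of q^(-as) over a >= 1, so [1 + eweight q] is the Euler
    factor at an odd prime q. The prime 2 is accounted for in [rankin_const]. *)
Definition eweight (q : nat) : R :=
  if prime q && odd q then z ^+ f q * (npow q / (1 - npow q)) else 0.

Lemma eweight_ge0 q : 0 <= eweight q.
Proof.
rewrite /eweight; case: ifP => // /andP[pq _].
by rewrite mulr_ge0 ?exprn_ge0 ?divr_ge0 ?subr_ge0 ?ltW ?npow_gt0 ?npow_lt1 ?prime_gt1.
Qed.

(* No constant term at [q = 2]: the product ranges over even m only. *)
Definition factor (q a : nat) : R :=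
  if a == 0%N then (q != 2)%:R
  else if prime q then z ^+ f q * npow q ^+ a else 0.

Lemma factor_ge0 q a : 0 <= factor q a.
Proof.
rewrite /factor; case: ifP => // _; case: ifP => // _.
by rewrite mulr_ge0 ?exprn_ge0 ?ltW ?npow_gt0.
Qed.

(** Evenness of m keeps the factor at 2 from vanishing. A composite q has [logn q m = 0] and
    contributes 1, and z^(f q) occurs once whatever the exponent of q in m. *)
Lemma prod_factor m n : (0 < m < n)%N -> ~~ odd m ->
  z ^+ (\sum_(q <- primes m) f q) * npow m = \prod_(q < n) factor q (logn q m).
Proof.
move=> mn om; rewrite (npow_prod_logn mn) (sum_primes_ord _ mn) -prodrXr big_mkcond/=.
rewrite -big_split /=; apply: eq_bigr => q _; rewrite /factor logn_gt0 -[_ == _]negbK -lt0n logn_gt0.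
have [qm|qm] /= := boolP (nat_of_ord q \in primes m).
  by move: qm; rewrite mem_primes => /and3P[->].
have -> : logn q m = 0%N by apply/eqP; rewrite -[_ == _]negbK -lt0n logn_gt0.
rewrite expr0 mulr1; case: eqP => // q2; move: qm.
by rewrite q2 mem_primes dvdn2 om /=; case/andP: mn => ->.
Qed.

Lemma sum_factor_le n q : \sum_(a < n.+1) factor q a <=
  (q != 2)%:R + (if prime q then z ^+ f q * (npow q / (1 - npow q)) else 0).
Proof.
rewrite big_ord_recl lerD2l /factor /=; case: ifP => [pq|_]; last by rewrite big1.
under eq_bigr do rewrite /bump /= add1n exprS.
rewrite -!mulr_sumr ler_pM2l ?exprn_gt0// ler_pM2l ?npow_gt0//.
by apply: geometric_le; rewrite ltW ?npow_gt0// npow_lt1 ?prime_gt1.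
Qed.

Lemma f2 : f 2 = 1%N. Proof. by rewrite f_rec// big_nil. Qed.

Lemma sum_even_le n :
  \sum_(m < n | (0 < m)%N && ~~ odd m) z ^+ (\sum_(q <- primes m) f q) * npow m
  <= z * (npow 2 / (1 - npow 2)) * \prod_(q < n) (1 + eweight q).
Proof.
have C0 : 0 <= z * (npow 2 / (1 - npow 2)).
  by rewrite mulr_ge0 ?(ltW z0)// divr_ge0 ?subr_ge0 ?ltW ?npow_gt0 ?npow_lt1.
(* For n <= 2 there is no positive even m below n, and 2 is not an index of the product. *)
have [n2|n2] := leqP n 2.
  rewrite big1 ?(mulr_ge0 C0)// ?prodr_ge0// => [q _|[m mn]].
    by rewrite addr_ge0 ?eweight_ge0.
  by case: m mn => [//|[//|m]] /= mn _; exfalso; lia.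
have n0 : (0 < n)%N by lia.
apply: (@le_trans _ _ (\sum_(m < n | (0 < m)%N) \prod_(q < n) factor q (logn q m))).
  rewrite big_mkcondr ler_sum// => m m0; case: ifP => om.
    by rewrite (@prod_factor _ n) ?m0 ?ltn_ord ?lexx.
  by rewrite prodr_ge0// => q _; exact: factor_ge0.
apply: (le_trans (sum_le_euler n factor_ge0)).
(* The factor at 2 starts at a = 1 and yields the constant in front; on the right [eweight 2 = 0]
   leaves a factor 1. *)
rewrite (bigD1 (Ordinal n2)) //= [in leRHS](bigD1 (Ordinal n2)) //=.
rewrite {1}/eweight /= addr0 mul1r; apply: ler_pM.
- by rewrite sumr_ge0// => a _; exact: factor_ge0.
- by rewrite prodr_ge0// => q _; rewrite sumr_ge0// => a _; exact: factor_ge0.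
- by case: (n) n0 => // k _; rewrite (le_trans (sum_factor_le _ _))//= f2 add0r.
apply: ler_prod => q /eqP q2; rewrite sumr_ge0/=; last by move=> a _; exact: factor_ge0.
have {}q2 : (q : nat) != 2 by apply/eqP => e; apply: q2; exact: val_inj.
case: (n) n0 q q2 => // k _ q q2; rewrite (le_trans (sum_factor_le _ _))//= q2 lerD2l /eweight.
case: ifP => //= pq; case: ifP => // oq.
by move: q2 oq; case: (even_prime pq) => -> //; rewrite pq.
Qed.

(** The K of the opening comment: the Euler factor z 2^-s / (1 - 2^-s) at 2, times the loss z / (1 -
    3^-s) in passing from p to p - 1. *)
Definition rankin_const : R :=
  z ^+ 2 * npow 2 / ((1 - npow 2) * (1 - npow 3)).

(** For the prime p = m + 1 the recursion for [f] gives z^(f p) as z times the product over the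
    primes dividing m; moreover p^-s <= m^-s, and p >= 3 bounds 1 / (1 - p^-s). *)
Lemma eweight_le m : (0 < m)%N -> eweight m.+1 <=
  z / (1 - npow 3) *
  (if ~~ odd m then z ^+ (\sum_(q <- primes m) f q) * npow m else 0).
Proof.
move=> m0; have d3 : 0 < 1 - npow 3 by rewrite subr_gt0 npow_lt1.
rewrite /eweight /=; case: ifP => [/andP[pm om]|_]; last first.
  by rewrite mulr_ge0 ?divr_ge0 ?(ltW z0) ?(ltW d3)//; case: ifP => // _;
    rewrite mulr_ge0 ?exprn_ge0 ?ltW ?npow_gt0.
rewrite om f_rec//= exprD expr1 -!mulrA ler_pM2l// [in leRHS]mulrCA.
rewrite ler_pM2l ?exprn_gt0// mulrC; apply: ler_pM.
- by rewrite invr_ge0 subr_ge0 ltW ?npow_lt1.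
- exact/ltW/npow_gt0.
- rewrite lef_pV2 ?posrE ?subr_gt0 ?npow_lt1// lerD2l lerN2 le_npow//.
  by rewrite ltnS; case: m m0 om {pm} => [//|[//|m]].
- exact: le_npow.
Qed.

(** A prime q <= n becomes m = q - 1 < n, whose prime factors are again below n: this shortens the
    range by one. The Euler product turns into an exponential by 1 + x <= e^x. *)
Lemma sum_eweight_rec n :
  \sum_(q < n.+1) eweight q <= rankin_const * expR (\sum_(q < n) eweight q).
Proof.
have d2 : 0 < 1 - npow 2 by rewrite subr_gt0 npow_lt1.
have d3 : 0 < 1 - npow 3 by rewrite subr_gt0 npow_lt1.
rewrite big_ord_recl {1}/eweight /= add0r.
apply: (@le_trans _ _ (z / (1 - npow 3) * \sum_(m < n | (0 < m)%N && ~~ odd m)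
    z ^+ (\sum_(q <- primes m) f q) * npow m)).
  rewrite big_mkcondr mulr_sumr [leRHS]big_mkcond ler_sum//= => m _.
  by case: ifP => [m0|/negbT]; [exact: eweight_le | case: m => -[]].
apply: (@le_trans _ _ (z / (1 - npow 3) * (z * (npow 2 / (1 - npow 2)) *
    \prod_(q < n) (1 + eweight q)))).
  by rewrite ler_wpM2l ?divr_ge0 ?(ltW z0) ?(ltW d3)// sum_even_le.
rewrite mulrA; have -> : z / (1 - npow 3) * (z * (npow 2 / (1 - npow 2))) = rankin_const.
  by rewrite /rankin_const; field; rewrite !gt_eqF.
rewrite ler_wpM2l ?divr_ge0 ?mulr_ge0 ?exprn_ge0 ?(ltW z0) ?(ltW d2) ?(ltW d3) ?(ltW (npow_gt0 _))//.
rewrite expR_sum; apply: ler_prod => q _.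
by rewrite addr_ge0 ?eweight_ge0//= expR_ge1Dx.
Qed.

(** If y <= 1 then K e^y <= K e <= 1. In the extreme case K = 1/e, the value 1 is the fixed point of
    K e^y. *)
Lemma sum_eweight_le1 n : rankin_const * expR 1 <= 1 ->
  \sum_(q < n) eweight q <= 1.
Proof.
move=> K1; elim: n => [|n IH]; first by rewrite big_ord0 ler01.
apply: (le_trans (sum_eweight_rec n)); apply: le_trans K1.
rewrite ler_wpM2l ?ler_expR//.
by rewrite /rankin_const divr_ge0 ?mulr_ge0 ?exprn_ge0 ?subr_ge0 ?(ltW z0) ?ltW ?npow_gt0 ?npow_lt1.
Qed.

Lemma rankin n : rankin_const * expR 1 <= 1 ->
  \sum_(p < n | prime p && odd p) z ^+ f p * npow p <= 1.
Proof.
move=> /(sum_eweight_le1 n); apply: le_trans.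
rewrite big_mkcond ler_sum//= => p _; rewrite /eweight; case: ifP => // /andP[pp _].
rewrite ler_pM2l ?exprn_gt0// ler_peMr ?(ltW (npow_gt0 _))// -[leLHS]invr1.
by rewrite lef_pV2 ?posrE ?subr_gt0 ?npow_lt1 ?prime_gt1// gerBl ltW ?npow_gt0.
Qed.

End Rankin.

(** * Numerical bounds and the condition K e <= 1 *)

Lemma expR_ge_taylor (R : realType) (n : nat) (x : R) : 0 <= x ->
  \sum_(k < n) x ^+ k / k`!%:R <= expR x.
Proof.
move=> x0; have -> : \sum_(k < n) x ^+ k / k`!%:R = series (exp_coeff x) n.
  by rewrite /series /= big_mkord.
rewrite /expR; apply: nondecreasing_cvgn_le.
  apply: nondecreasing_series => k _ _.
  by rewrite /exp_coeff /= divr_ge0 ?exprn_ge0.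
exact: is_cvg_series_exp_coeff.
Qed.

(** Raise e^(-x/n) >= 1 - x/n >= c to the n-th power and invert. *)
Lemma expR_le_pow (R : realType) (n : nat) (x c : R) :
  (0 < n)%N -> 0 < c -> c <= 1 - x / n%:R -> expR x <= (c ^+ n)^-1.
Proof.
move=> n0 c0 hc; rewrite -[x]opprK expRN lef_pV2 ?posrE ?expR_gt0 ?exprn_gt0//.
rewrite (_ : - x = n%:R * (- x / n%:R)); last by rewrite mulrC divfK// pnatr_eq0 -lt0n.
rewrite expRM_natl lerXn2r ?nnegrE ?expR_ge0 ?(ltW c0)//.
by rewrite (le_trans hc)// mulNr expR_ge1Dx.
Qed.

Lemma expR1_le (R : realType) : expR 1 <= 274 / 100 :> R.
Proof.
by apply: (le_trans (@expR_le_pow _ 128 _ (127 / 128) _ _ _)) => //; lra.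
Qed.

Lemma ln2_ge (R : realType) : 69 / 100 <= ln 2 :> R.
Proof.
rewrite -ler_expR lnK ?posrE//.
(* 369/371 lies just below 1 - 0.69/128, and its 128th power still exceeds 1/2; 349/352 plays the
   same role for [ln 3]. *)
apply: (le_trans (@expR_le_pow _ 128 _ (369 / 371) _ _ _)); [by []|lra|lra|].
by rewrite -[leRHS]invrK lef_pV2 ?posrE; lra.
Qed.

Lemma ln3_ge (R : realType) : 109 / 100 <= ln 3 :> R.
Proof.
rewrite -ler_expR lnK ?posrE//.
apply: (le_trans (@expR_le_pow _ 128 _ (349 / 352) _ _ _)); [by []|lra|lra|].
by rewrite -[leRHS]invrK lef_pV2 ?posrE; lra.
Qed.

(** Multiplying numerator and denominator by 2^s leaves a condition that needs only lower bounds on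
    E = 2^s and W = 3^s. *)
Lemma rankin_const_le1 (R : realType) (s z E W : R) :
  E = expR (s * ln 2) -> W = expR (s * ln 3) -> 1 < E -> 1 < W ->
  z ^+ 2 * expR 1 <= (E - 1) * (1 - W^-1) ->
  rankin_const z s * expR 1 <= 1.
Proof.
move=> hE hW E1 W1; rewrite /rankin_const /npow !mulNr !expRN -hE -hW => h.
have E0 : 0 < E by lra.
have W0 : 0 < W by lra.
have -> : z ^+ 2 * E^-1 / ((1 - E^-1) * (1 - W^-1)) * expR 1 =
   z ^+ 2 * expR 1 / ((E - 1) * (1 - W^-1)).
  by field; rewrite !gt_eqF//=; lra.
rewrite ler_pdivrMr ?mul1r// mulr_gt0 ?subr_gt0//.
by rewrite -invr1 ltf_pV2 ?posrE.
Qed.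

(* Here t and w stand for lower bounds of s ln 2 and s ln 3, the bracketed
   sums for Taylor bounds of 2^s - 1 and 3^s - 1, and 0.5715 > e^3 / 36. *)
Lemma poly_bound (R : realFieldType) (s : R) : 0 < s ->
  let t := 69 / 100 * s in let w := 109 / 100 * s in
  5715 / 10000 * s ^+ 2 * (1 + w + w ^+ 2 / 2) <=
  (t + t ^+ 2 / 2 + t ^+ 3 / 6 + t ^+ 4 / 24) * (w + w ^+ 2 / 2).
Proof.
(* The quartic is the difference of the two sides divided by s^2, with coefficients rounded down. *)
move=> s0 /=; suff : 0 <= 1806 / 10000 + 46 / 1000 * s - 1385 / 10000 * s ^+ 2
   + 427 / 10000 * s ^+ 3 + 55 / 10000 * s ^+ 4 :> R.
  move=> h; have : 0 <= s ^+ 2 * (1806 / 10000 + 46 / 1000 * s - 1385 / 10000 * s ^+ 2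
   + 427 / 10000 * s ^+ 3 + 55 / 10000 * s ^+ 4) by rewrite mulr_ge0 ?sqr_ge0.
  have := exprn_gt0 2 s0; have := exprn_gt0 3 s0; have := exprn_gt0 4 s0;
  have := exprn_gt0 5 s0; have := exprn_gt0 6 s0.
  by lra.
have := sqr_ge0 (s ^+ 2 - 2); have := sqr_ge0 (s - 17 / 10); have h := sqr_ge0 (s - 28 / 10).
have : 0 <= s * (s - 17 / 10) ^+ 2 by rewrite mulr_ge0 ?sqr_ge0// ltW.
by nra.
Qed.

(** The condition reads e^3 s^2 / 36 <= (2^s - 1)(1 - 3^-s). Near s = 0 it needs e^3 / 36 <= ln 2 ln
    3; Taylor polynomials of 2^s and 3^s treat all s > 0 at once. *)
Lemma rankin_const_linear (R : realType) (s : R) : 0 < s ->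
  rankin_const (expR 1 / 6 * s) s * expR 1 <= 1.
Proof.
move=> s0; pose t := 69 / 100 * s; pose w := 109 / 100 * s.
have t0 : 0 < t by rewrite mulr_gt0//; lra.
have w0 : 0 < w by rewrite mulr_gt0//; lra.
have Ht : 1 + (t + t ^+ 2 / 2 + t ^+ 3 / 6 + t ^+ 4 / 24) <= expR (s * ln 2).
  apply: (@le_trans _ _ (expR t)); last first.
    by rewrite ler_expR /t [leRHS]mulrC ler_pM2r// ln2_ge.
  apply: le_trans (expR_ge_taylor 5 (ltW t0)).
  by rewrite !big_ord_recl big_ord0 /= /bump /= !factS fact0 !(add1n, muln1, natrM) expr0; lra.
have Hw : 1 + w + w ^+ 2 / 2 <= expR (s * ln 3).
  apply: (@le_trans _ _ (expR w)); last first.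
    by rewrite ler_expR /w [leRHS]mulrC ler_pM2r// ln3_ge.
  apply: le_trans (expR_ge_taylor 3 (ltW w0)).
  by rewrite !big_ord_recl big_ord0 /= /bump /= !factS fact0 !(add1n, muln1, natrM) expr0; lra.
have := exprn_gt0 2 t0; have := exprn_gt0 3 t0; have := exprn_gt0 4 t0 => t4 t3 t2.
have w2 := exprn_gt0 2 w0.
set T := t + t ^+ 2 / 2 + t ^+ 3 / 6 + t ^+ 4 / 24 in Ht.
have T0 : 0 < T by rewrite /T; lra.
apply: (@rankin_const_le1 _ _ _ _ _ erefl erefl); rewrite ?expR_gt1 ?mulr_gt0 ?ln_gt0 ?ltr1n//.
apply: (@le_trans _ _ (5715 / 10000 * s ^+ 2)).
  have -> : (expR 1 / 6 * s) ^+ 2 * expR 1 = expR 1 ^+ 3 / 36 * s ^+ 2 :> R by field.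
  rewrite ler_pM2r ?exprn_gt0//.
  have : expR 1 ^+ 3 <= (274 / 100) ^+ 3 :> R by rewrite lerXn2r ?nnegrE ?expR_ge0 ?expR1_le//; lra.
  by lra.
set q := 1 + w + w ^+ 2 / 2 in Hw.
have q0 : 0 < q by rewrite /q; lra.
apply: (@le_trans _ _ (T * (1 - q^-1))).
  have -> : T * (1 - q^-1) = T * (w + w ^+ 2 / 2) / q.
    by rewrite -mulrA; congr (_ * _); rewrite /q; field; rewrite gt_eqF//; lra.
  by rewrite ler_pdivlMr//; exact: poly_bound.
apply: ler_pM; rewrite ?(ltW T0)//.
- by rewrite subr_ge0 invf_le1//; rewrite /q; lra.
- by lra.
- by rewrite lerD2l lerN2 lef_pV2// posrE expR_gt0.
Qed.

(** * Counting primes by their Rankin weight; part (ii) *)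

Section Counting.
Variable R : realType.
Implicit Types (x z s w : R) (P Q : nat -> Prop).

Lemma count_primesE P x : count_primes P x =
  count (fun p => `[< [/\ prime p, p%:R <= x & P p] >]) (iota 0 (Num.truncn x).+1).
Proof.
rewrite -size_filter; apply/perm_size/uniq_perm.
- exact: fset_uniq.
- exact/filter_uniq/iota_uniq.
move=> p; rewrite mem_filter mem_iota /= add0n ltnS.
have -> : (p \in (fset_set (primes_upto P x) : seq nat)) =
  (p \in fset_set (primes_upto P x)) by [].
rewrite in_fset_set; last exact: finite_primes_upto.
apply/idP/andP => [/set_mem h|[/asboolP h _]]; last exact/mem_set.
by split; [exact/asboolP | case: h => _ /leq_truncn_of].
Qed.

Lemma le_count_primes P Q x :
  (forall p, prime p -> p%:R <= x -> P p -> Q p) ->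
  (count_primes P x <= count_primes Q x)%N.
Proof.
move=> PQ; rewrite !count_primesE; apply: sub_count => p /asboolP[pp px Pp].
by apply/asboolP; split=> //; exact: PQ.
Qed.

(** The Rankin sum sees odd primes only; the prime 2 costs at most 1. *)
Lemma count_primes_odd P x :
  (count_primes P x <= 1 + count_primes (fun p => odd p /\ P p) x)%N.
Proof.
rewrite !count_primesE; set s := iota _ _.
apply: (@leq_trans (count (pred1 2) s + count (fun p : nat => `[< [/\ prime p, p%:R <= x & odd p /\ P p] >]) s)).
  rewrite -count_predUI; apply: leq_trans (leq_addr _ _).
  apply: sub_count => p /asboolP[pp px Pp]; apply/orP.
  by case: (even_prime pp) => [->|op]; [left | right; apply/asboolP].
by rewrite leq_add2r count_uniq_mem ?iota_uniq// leq_b1.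
Qed.

(** Markov's inequality: each counted prime contributes at least w to a sum bounded by 1. *)
Lemma count_primes_weight P x z s w : 0 < z -> 0 < s -> rankin_const z s * expR 1 <= 1 ->
  (forall p, prime p -> odd p -> p%:R <= x -> P p -> w <= z ^+ f p * npow s p) ->
  (count_primes (fun p => odd p /\ P p) x)%:R * w <= 1.
Proof.
move=> z0 s0 hK hw; rewrite count_primesE -sum1_count natr_sum mulr_suml.
apply: le_trans (rankin z0 s0 (Num.truncn x).+1 hK).
rewrite -(big_mkord (fun p => prime p && odd p) (fun p => z ^+ f p * npow s p)).
rewrite /index_iota subn0 big_mkcond [leRHS]big_mkcond; apply: ler_sum => p _.
case: asboolP => [[pp px [op Pp]]|_]; first by rewrite pp op mul1r hw.
by case: ifP => // _; rewrite mulr_ge0 ?exprn_ge0 ?ltW ?npow_gt0.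
Qed.

Lemma f_ge2 p : prime p -> odd p -> (2 <= f p)%N.
Proof.
move=> pp op; rewrite f_rec// add1n ltnS.
have p2 : 2 \in primes p.-1.
  rewrite mem_primes dvdn2 /=; have := prime_gt1 pp.
  by case: p op {pp} => [//|[//|p]] /=; rewrite negbK => ->.
by rewrite (big_rem _ p2) /= f2 leq_addr.
Qed.

Lemma le_expRN_npow s x p : 0 < s -> prime p -> p%:R <= x ->
  expR (- s * ln x) <= npow s p.
Proof.
move=> s0 pp px; have p0 : 0 < p%:R :> R by rewrite ltr0n prime_gt0.
rewrite ler_expR !mulNr lerN2 ler_pM2l// ler_ln ?posrE//.
exact: lt_le_trans px.
Qed.

Lemma count_f_eq_le x h : 3%:R <= x -> (0 < h)%N ->
  (count_primes (fun p => f p = h) x)%:R <= (6%:R * ln x / h%:R) ^+ h.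
Proof.
move=> x3 h0; have x0 : 0 < x by lra.
have l1 : 1 <= ln x.
  apply: (@le_trans _ _ (ln 3)); first by have := ln3_ge R; lra.
  by rewrite ler_ln ?posrE.
(* Only p = 2 has [f p = 1]. For h >= 2 the prime 2 is not counted, so restricting to odd primes
   loses nothing. *)
have [h1|h1] := leqP h 1.
  have -> : h = 1%N by case: h h0 h1 => [//|[]].
  rewrite expr1 divr1; apply: (@le_trans _ _ 1); last by lra.
  rewrite lern1; apply: (leq_trans (count_primes_odd _ _)).
  rewrite count_primesE (@eq_count _ _ pred0) ?count_pred0// => p.
  by apply/negbTE/asboolPn => -[pp _ [op e]]; have := f_ge2 pp op; rewrite e.
(* With this s, x^-s = e^-h cancels the e^h in z^h = (e s / 6)^h, and the weight is (s / 6)^h. *)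
have [s hs] : exists s, s = h%:R / ln x by eexists.
have s0 : 0 < s by rewrite hs divr_gt0 ?ltr0n//; lra.
have z0 : 0 < expR 1 / 6 * s by rewrite mulr_gt0// divr_gt0 ?expR_gt0.
have -> : (6%:R * ln x / h%:R) ^+ h = ((s / 6) ^+ h)^-1.
  rewrite -exprVn; congr (_ ^+ _); rewrite hs; field.
  by rewrite pnatr_eq0 -lt0n h0 gt_eqF//; lra.
rewrite -[leRHS]mul1r ler_pdivlMr ?exprn_gt0 ?divr_gt0//.
apply: (@le_trans _ _ ((count_primes (fun p => odd p /\ f p = h) x)%:R * (s / 6) ^+ h)).
  rewrite ler_wpM2r ?exprn_ge0 ?divr_ge0 ?(ltW s0)// ler_nat; apply: le_count_primes => p pp _ fp.
  by split=> //; case: (even_prime pp) => // p2; move: fp h1; rewrite p2 f2 => <-.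
apply: (count_primes_weight z0 s0 (rankin_const_linear s0)) => p pp op px ->.
apply: (@le_trans _ _ ((expR 1 / 6 * s) ^+ h * expR (- s * ln x))); last first.
  by rewrite ler_pM2l ?exprn_gt0// le_expRN_npow.
rewrite (_ : - s * ln x = - h%:R); last by rewrite mulNr hs divfK//; lra.
rewrite (_ : expR 1 / 6 * s = s / 6 * expR 1); last by ring.
by rewrite [in leRHS]exprMn -[in leRHS]mulrA -expRM_natl mulr1 -expRD subrr expR0 mulr1.
Qed.

End Counting.

(** * The lower bound on f for almost all primes *)

Section AlmostAll.
Variable R : realType.
Implicit Types x : R.

(** The condition is exp(-2.304) <= (2^(3/8) - 1)(1 - 3^(-3/8)), about 0.0999 against 0.1002, so the
    rational approximations must be sharp. *)
Lemma rankin_const_fixed : rankin_const (expR (- (1652 / 1000))) (3 / 8) * expR 1 <= 1 :> R.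
Proof.
have root8 (a c : R) : 0 < a -> 0 < c -> a ^+ 8 <= c ^+ 3 -> a <= expR (3 / 8 * ln c).
  move=> a0 c0 h; rewrite -(@ler_pXn2r _ 8) ?nnegrE ?expR_ge0 ?(ltW a0)//.
  rewrite -expRM_natl (_ : 8 * (3 / 8 * ln c) = 3%:R * ln c); last by field.
  by rewrite expRM_natl lnK ?posrE.
have hE : 1621 / 1250 <= expR (3 / 8 * ln 2) :> R by apply: root8; lra.
have hW : 1887 / 1250 <= expR (3 / 8 * ln 3) :> R by apply: root8; lra.
apply: (@rankin_const_le1 _ _ _ _ _ erefl erefl); [lra|lra|].
(* Since 2.304 = 8 * 0.288, this bounds z^2 e by (3/4)^8. *)
have he : 4 / 3 <= expR (36 / 125) :> R.
  have h0 : 0 <= 36 / 125 :> R by lra.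
  apply: le_trans (expR_ge_taylor 4 h0).
  by rewrite !big_ord_recl big_ord0 /= /bump /= !factS fact0 !(add1n, muln1, natrM) expr0; lra.
rewrite -expRM_natl -expRD (_ : 2 * - (1652 / 1000) + 1 = - (8 * (36 / 125))); last by field.
rewrite expRN expRM_natl.
apply: (@le_trans _ _ ((4 / 3) ^+ 8)^-1).
  by rewrite lef_pV2 ?posrE ?exprn_gt0 ?expR_gt0// lerXn2r ?nnegrE ?expR_ge0//; lra.
apply: (@le_trans _ _ ((1621 / 1250 - 1) * (1 - (1887 / 1250)^-1))); first by lra.
apply: ler_pM; [lra|lra|lra|].
by rewrite lerD2l lerN2 lef_pV2 ?posrE ?expR_gt0; lra.
Qed.

(* 3/8 + 0.378 * 1.652 = 0.999456 < 1999/2000 *)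
Lemma count_small_f_le x : 1 <= x ->
  (count_primes (fun p => (f p)%:R < 378 / 1000 * ln x) x)%:R
    <= 2 * expR (1999 / 2000 * ln x).
Proof.
move=> x1; have l0 : 0 <= ln x by rewrite ln_ge0.
have s0 : 0 < 3 / 8 :> R by lra.
have := count_primes_weight (P := fun p => (f p)%:R < 378 / 1000 * ln x) (x := x)
  (w := expR (- (1999 / 2000 * ln x))) (expR_gt0 _) s0 rankin_const_fixed.
set c := count_primes (fun p => odd p /\ _) x => hw.
have {}hw : c%:R * expR (- (1999 / 2000 * ln x)) <= 1.
  (* As z < 1, a small [f p] makes z^(f p) large: at least x^(-0.624456). *)
  apply: hw => p pp op px fp.
  apply: (@le_trans _ _ (expR ((f p)%:R * - (1652 / 1000)) * expR (- (3 / 8) * ln x))).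
    by rewrite -expRD ler_expR; lra.
  by rewrite expRM_natl ler_pM2l ?exprn_gt0 ?expR_gt0// le_expRN_npow.
have h2 : c%:R <= expR (1999 / 2000 * ln x).
  by move: hw; rewrite expRN ler_pdivrMr ?expR_gt0// mul1r.
have h1 : 1 <= expR (1999 / 2000 * ln x) by rewrite -[X in X <= _]expR0 ler_expR; lra.
have := count_primes_odd (fun p => (f p)%:R < 378 / 1000 * ln x) x.
by rewrite -(ler_nat R) natrD -/c; lra.
Qed.

(** For L = ln x this makes the exceptional count at most e x / ln x, both for the density statement
    and for the bound on [N]. *)
Lemma expR_dominates (e : R) : 0 < e ->
  exists2 M, 1 <= M & forall L, M <= L ->
    2 * expR (1999 / 2000 * L) * L <= e * expR L.
Proof.
(* From 4000^2 / e on, the quadratic Taylor term e (L / 2000)^2 / 2 of e exp(L / 2000) exceeds 2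
   L. *)
move=> e0; exists (4000 * 4000 / e + 1) => [|L hL].
  by rewrite lerDr !(mulr_ge0, invr_ge0) ?ler0n ?(ltW e0).
have L1 : 4000 * 4000 / e <= L by lra.
have L0 : 0 < L by apply: lt_le_trans hL; rewrite addr_gt0 ?divr_gt0 ?mulr_gt0 ?ltr0n ?ltr01.
have -> : expR L = expR (1999 / 2000 * L) * expR (L / 2000).
  by rewrite -expRD; congr expR; field.
rewrite [leRHS]mulrCA -mulrA [leLHS]mulrCA ler_pM2l ?expR_gt0//.
have h0 : 0 <= L / 2000 by lra.
have h := expR_ge_taylor 3 h0.
rewrite !big_ord_recl big_ord0 /= /bump /= !factS fact0 !(add1n, muln1, natrM) expr0 in h.
apply: (@le_trans _ _ (e * ((L / 2000) ^+ 2 / 2))); last first.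
  by rewrite ler_pM2l//; lra.
rewrite (_ : e * _ = 2 * L * (e * L / (4000 * 4000))); last by field.
rewrite ler_peMr ?mulr_ge0 ?ler0n ?(ltW L0)//.
rewrite ler_pdivlMr ?mulr_gt0 ?ltr0n ?ltr01// mul1r [leRHS]mulrC.
by rewrite -ler_pdivrMr.
Qed.

(** An exceptional p <= x has f p < 0.378 ln p <= 0.378 ln x, so [count_small_f_le] counts it. *)
Lemma almost_all_f_ge : almost_all_primes R
  (fun p : nat => (378%:R / 1000%:R) * ln (p%:R : R) <= (f p)%:R).
Proof.
apply/almost_all_primesP => e /expR_dominates[M M1 hM].
near=> x.
have x1 : expR M <= x by near: x; exact: nbhs_pinfty_ge.
have x0 : 0 < x := lt_le_trans (expR_gt0 M) x1.
have L1 : M <= ln x by rewrite -ler_expR lnK.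
have l0 : 0 < ln x by lra.
have {}x1 : 1 <= x by rewrite (le_trans _ x1)// -[X in X <= _]expR0 ler_expR; lra.
have := hM _ L1; rewrite lnK ?posrE// mulrA -ler_pdivlMr//; apply: le_trans.
apply: le_trans (count_small_f_le x1).
rewrite ler_nat; apply: le_count_primes => p pp px /negP; rewrite -ltNge => /lt_le_trans; apply.
apply: ler_wpM2l; first by rewrite divr_ge0 ?ler0n.
by rewrite ler_ln ?posrE ?ltr0n ?prime_gt0.
Unshelve. all: by end_near.
Qed.

End AlmostAll.

(** * Chebyshev's lower bound via the central binomial coefficient *)

Lemma expn2_le_central_bin n : (2 ^ n <= 'C(n.*2, n))%N.
Proof.
elim: n => [|n IH]; first by rewrite bin0.
(* Pascal splits C(2n+2, n+1) into C(2n+1, n+1) and C(2n+1, n), each at least C(2n, n). *)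
rewrite expnS mul2n -addnn doubleS [leqRHS]binS; apply: leq_add; apply: leq_trans IH _.
  by rewrite binS leq_addl.
by case: n => [|n]; rewrite ?bin0// [leqRHS]binS leq_addr.
Qed.

Lemma logn_fact_widen p m n : prime p -> (m <= n)%N ->
  logn p m`! = (\sum_(1 <= k < n.+1) m %/ p ^ k)%N.
Proof.
move=> pp mn; rewrite logn_fact// [RHS](@big_cat_nat _ _ _ m.+1)//=.
rewrite [X in (_ + X)%N]big_nat_cond [X in (_ + X)%N]big1 ?addn0// => k /andP[/andP[mk _] _].
by rewrite divn_small// (leq_trans mk)// ltnW// ltn_expl// prime_gt1.
Qed.

Lemma logn_central_bin p n : prime p ->
  (logn p 'C(n.*2, n) <= trunc_log p n.*2)%N.
Proof.
move=> pp; have p1 := prime_gt1 pp.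
have nn : (n <= n.*2)%N by rewrite -addnn leq_addr.
have e : (logn p 'C(n.*2, n) + (logn p n`! + logn p n`!) = logn p (n.*2)`!)%N.
  rewrite -(bin_fact nn) -addnn addnK !lognM ?muln_gt0 ?fact_gt0 ?bin_gt0 ?leq_addr//.
(* Legendre: each k contributes [2n / p^k] - 2 [n / p^k] <= 1, and 0 if p^k > 2n. *)
rewrite -(leq_add2r (logn p n`! + logn p n`!)) e.
rewrite !(@logn_fact_widen p _ n.*2)// -big_split /=.
(* The logarithm counts the k >= 1 with p^k <= 2n, which permits a termwise comparison. *)
have -> : trunc_log p n.*2 = (\sum_(1 <= k < n.*2.+1) (p ^ k <= n.*2))%N.
  have [->|n0] := posnP n; first by rewrite double0 trunc_log0 big_nil.
  have tl : (trunc_log p n.*2 <= n.*2)%N.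
    rewrite (leq_trans (ltnW (ltn_expl _ p1)))// trunc_logP// double_gt0//.
  rewrite (@big_cat_nat _ _ _ (trunc_log p n.*2).+1)//=.
  rewrite (eq_big_nat _ _ (F2 := fun=> 1%N)); last first.
    move=> k /andP[_ kt]; rewrite (leq_trans _ (trunc_logP p1 _)) ?double_gt0//.
    by rewrite leq_exp2l.
  rewrite sum_nat_const_nat subn1 muln1 big_nat_cond [X in (_ + X)%N]big1 ?addn0// => k /andP[/andP[kt _] _].
  by apply/eqP; rewrite eqb0 -ltnNge; apply: leq_trans (trunc_log_ltn _ p1) _; rewrite leq_exp2l.
rewrite -big_split /=; apply: leq_sum => k _.
have pk : (0 < p ^ k)%N by rewrite expn_gt0 prime_gt0.
have [h|h] := leqP (p ^ k) n.*2; last by rewrite divn_small.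
have h1 := leq_trunc_div n.*2 (p ^ k); have h2 := ltn_ceil n pk.
by rewrite -ltnS -(ltn_pmul2r pk) (leq_ltn_trans h1)//; nia.
Qed.

Section LowerBounds.
Variable R : realType.
Implicit Types x : R.

(** Let 2n be the largest even integer <= x. Each prime power exactly dividing C(2n, n) is at most
    2n <= x, so 2^n <= C(2n, n) <= x^pi(x); take logarithms. *)
Lemma chebyshev_lower x : 4 <= x ->
  ln 2 / 4 * x <= (count_primes (fun=> True) x)%:R * ln x.
Proof.
move=> x4; have x0 : 0 < x by lra.
set m := Num.truncn x; pose n := m./2.
have mx : m%:R <= x by rewrite truncn_le ltW.
have xm : x < m.+1%:R by rewrite truncnS_gt.
have nm : (n.*2 <= m)%N by rewrite -[leqRHS]odd_double_half leq_addl.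
have mn : (m.+1 <= n.*2 + 2)%N by rewrite -[m in leqLHS]odd_double_half -/n; case: odd; lia.
have n0 : (0 < n)%N.
  rewrite half_gt0 ltnNge; apply/negP => m1.
  have : m.+1%:R <= 2%:R :> R by rewrite ler_nat ltnS.
  by lra.
have bpos : (0 < 'C(n.*2, n))%N by rewrite bin_gt0 -addnn leq_addr.
have l0 : 0 <= ln x by rewrite ln_ge0//; lra.
have pB p : p \in primes 'C(n.*2, n) ->
    prime p /\ (p ^ logn p 'C(n.*2, n) <= n.*2)%N /\ (p <= n.*2)%N.
  rewrite mem_primes => /and3P[pp _ pd]; have p1 := prime_gt1 pp.
  have le2 : (p ^ logn p 'C(n.*2, n) <= n.*2)%N.
    apply: leq_trans (trunc_logP p1 _); last by rewrite double_gt0.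
    by rewrite leq_exp2l// logn_central_bin.
  split=> //; split=> //; apply: leq_trans le2.
  by rewrite -[leqLHS]expn1 leq_exp2l// logn_gt0 mem_primes pp bpos.
have n2x : (n.*2)%:R <= x by apply: le_trans mx; rewrite ler_nat.
have sz : (size (primes 'C(n.*2, n)) <= count_primes (fun=> True) x)%N.
  rewrite count_primesE -size_filter; apply: uniq_leq_size; first exact: primes_uniq.
  move=> p /pB[pp [_ pn]]; rewrite mem_filter mem_iota add0n ltnS /= (leq_trans pn)// andbT.
  by apply/asboolP; split=> //; apply: le_trans n2x; rewrite ler_nat.
have key : (2 ^ n)%:R <= x ^+ size (primes 'C(n.*2, n)).
  apply: (@le_trans _ _ ('C(n.*2, n))%:R).
    by rewrite ler_nat expn2_le_central_bin.
  rewrite [X in X%:R <= _](prod_prime_decomp bpos) prime_decompE big_map /= natr_prod.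
  rewrite -iter_mulr_1 -count_predT -big_const_seq big_seq [leRHS]big_seq; apply: ler_prod => p /pB[_ [h _]].
  by rewrite ler0n/= (le_trans _ n2x)// ler_nat.
have {}key : n%:R * ln 2 <= (count_primes (fun=> True) x)%:R * ln x.
  rewrite -ler_expR !expRM_natl !lnK ?posrE// -natrX (le_trans key)//.
  by rewrite ler_weXn2l//; lra.
apply: le_trans key; rewrite (_ : _ * x = x / 4 * ln 2); last by ring.
rewrite ler_pM2r ?ln_gt0 ?ltr1n//.
(* x < 2n + 2 and x >= 4 give n >= x / 4. *)
have : m.+1%:R <= (n.*2 + 2)%:R :> R by rewrite ler_nat.
by rewrite natrD -muln2 natrM; lra.
Qed.

(** * The linear lower bound for N *)

Lemma sum_f_le_N x :
  (\sum_(p <- iota 0 (Num.truncn x).+1 | `[< [/\ prime p, (p%:R <= x)%R & True] >]) f p <= N x)%N.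
Proof.
rewrite -big_filter; set s := [seq _ <- _ | _].
pose S q : seq (seq nat) := fset_set (chains_to q).
pose L := [seq c | p <- s, c <- S p].
have -> : (\sum_(p <- s) f p)%N = size L.
  by rewrite size_allpairs_dep sumnE big_map.
apply: uniq_leq_size.
  rewrite allpairs_uniq_dep ?filter_uniq ?iota_uniq//.
    by move=> q _; exact: fset_uniq.
  move=> [q c] [q' c'] /allpairsPdep[q1 [c1 [_ h [-> ->]]]].
  move=> /allpairsPdep[q2 [c2 [_ h' [-> ->]]]] /= e.
  move: h h'; rewrite e !mem_chains_to.
  by move=> /andP[_ /eqP<-] /andP[_ /eqP<-].
move=> c /allpairsPdep[p [d [ps dS ->]]].
have -> : (d \in (fset_set (chains_upto x) : seq (seq nat))) = (d \in fset_set (chains_upto x)) by [].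
rewrite in_fset_set; last exact: finite_chains_upto.
move: dS ps; rewrite mem_chains_to mem_filter => /andP[dc /eqP dl] /andP[/asboolP[_ px _] _].
by apply/mem_set; split=> //; rewrite dl.
Qed.

Lemma N_ge1 x : 2 <= x -> (1 <= N x)%N.
Proof.
move=> x2; rewrite cardfs_gt0; apply/fset0Pn; exists [:: 2].
rewrite in_fset_set; last exact: finite_chains_upto.
by apply/mem_set; split.
Qed.

(** Sort chains by their last prime; each prime with f p >= y ends at least y of them. *)
Lemma N_ge_count x (y : R) : 0 <= y ->
  y * ((count_primes (fun=> True) x)%:R - (count_primes (fun p => (f p)%:R < y) x)%:R)
    <= (N x)%:R.
Proof.
move=> y0; apply: (@le_trans _ _ ((\sum_(p <- iota 0 (Num.truncn x).+1 |
   `[< [/\ prime p, p%:R <= x & True] >]) f p)%:R)); last by rewrite ler_nat sum_f_le_N.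
rewrite !count_primesE -!sum1_count !natr_sum mulrBr !mulr_sumr lerBlDr.
rewrite big_mkcond [X in _ <= X + _]big_mkcond [X in _ <= _ + X]big_mkcond -big_split /=.
apply: ler_sum => p _; case: asboolP => [[pp px _]|h]; last first.
  by rewrite add0r; case: ifP; rewrite ?mulr1.
rewrite mulr1; have [h|h] := leP y (f p)%:R; first by rewrite ler_wpDr//; case: ifP; rewrite ?mulr1.
by rewrite asboolT ?mulr1 ?lerDr.
Qed.

Lemma N_linear_lower : exists2 c : R, 0 < c & forall x, 2%:R <= x -> c * x <= (N x)%:R.
Proof.
(* Half of Chebyshev's constant: the exceptional primes take at most half of the guaranteed
   primes. *)
have e0 : 0 < ln 2 / 8 :> R by rewrite divr_gt0 ?ln_gt0 ?ltr1n.
have [k k0 hk] : exists2 k : R, 0 < k & forall x, 1 <= x ->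
    (count_primes (fun p => (f p)%:R < k * ln x) x)%:R <= 2 * expR (1999 / 2000 * ln x).
  by exists (378 / 1000); [lra | exact: count_small_f_le].
have [M M1 hM] := expR_dominates e0.
pose K := Num.max 4 (expR M); have K0 : 0 < K by rewrite lt_max ltr0n.
(* [K^-1] serves the bounded range x <= K, where the single chain (2) suffices. *)
exists (Num.min K^-1 (k * (ln 2 / 8))) => [|x x2].
  by rewrite lt_min invr_gt0 K0 mulr_gt0.
have x0 : 0 < x by lra.
have [xK|Kx] := leP x K.
  apply: (@le_trans _ _ (K^-1 * x)); first by rewrite ler_pM2r// ge_min lexx.
  by rewrite mulrC (@le_trans _ _ 1)// ?ler_pdivrMr ?mul1r// ler1n N_ge1.
apply: (@le_trans _ _ (k * (ln 2 / 8) * x)).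
  by rewrite ler_pM2r// ge_min lexx orbT.
have x4 : 4 <= x by rewrite ltW// (le_lt_trans _ Kx)// le_max lexx.
have hx : expR M <= x by rewrite ltW// (le_lt_trans _ Kx)// le_max lexx orbT.
have L1 : M <= ln x by rewrite -ler_expR lnK.
have x1 : 1 <= x by lra.
have l0 : 0 <= ln x by lra.
have y0 : 0 <= k * ln x by rewrite mulr_ge0 ?(ltW k0).
apply: le_trans (N_ge_count x y0); rewrite -!mulrA ler_pM2l//.
rewrite mulrA; have := hM _ L1; rewrite lnK ?posrE// => h1.
have h2 := ler_wpM2r l0 (hk _ x1).
have h3 := chebyshev_lower x4.
by lra.
Qed.

End LowerBounds.

Theorem theorem2 (R : realType) :
  (almost_all_primes R
     (fun p : nat => (378%:R / 1000%:R) * ln (p%:R : R) <= (f p)%:R) /\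
   (exists2 c : R, 0 < c & forall x : R, 2%:R <= x -> c * x <= (N x)%:R)) /\
  (forall (x : R) (h : nat), 3%:R <= x -> (0 < h)%N ->
     (count_primes (fun p : nat => f p = h) x)%:R
       <= (6%:R * ln x / h%:R) ^+ h).
Proof.
split; last exact: count_f_eq_le.
by split; [exact: almost_all_f_ge | exact: N_linear_lower].
Qed.
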